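(* Fix $\mu_0\neq\mu_1$ such that private beliefs are unbounded from below, i.e.\ for every $\epsilon>0$, $\mathbb{P}(B_u<\epsilon)>0$. Then there is a sequence $q(n)=q(n,\mu_0,\mu_1)$, depending only on $\mu_0,\mu_1$, with $q(n)\to1$ as $n\to\infty$, such that the following holds: for every finite set $V$ of $n$ agents with private signals and information $\sigma$-algebras as in the context, having common knowledge of actions (for all $u,w\in V$, $L_u$ is a.s.\ $\mathcal{F}_w$-measurable) and a common optimal action set $L$ with $L=L_u$ almost surely for all $u\in V$, we have $$\mathbb{P}(L=\{0\}\mid S=0)\ge q(n).$$
   Context: The state $S$ is uniform on $\{0,1\}$. $\mu_0\neq\mu_1$ are probability measures on a measurable space $(\Omega,\mathcal{O})$ (the Radon–Nikodym derivative $d\mu_1/d\mu_0$ is assumed to exist). $V$ is a finite set of agents; agent $u$ has a private signal $W_u$, and conditionally on $S$ the signals are i.i.d.\ with law $\mu_S$. The private belief is $B_u=\mathbb{P}(S=1\mid W_u)$. Each agent has information $\sigma$-algebra $\mathcal{F}_u$ with $\sigma(W_u)\subseteq\mathcal{F}_u\subseteq\sigma(W_v:v\in V)$; posterior belief $X_u=\mathbb{P}(S=1\mid\mathcal{F}_u)$; posterior optimal action set $L_u=\{0\}$ if $X_u<1/2$, $\{1\}$ if $X_u>1/2$, $\{0,1\}$ if $X_u=1/2$. *)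

(* Defs.v *)
From HB Require Import structures.
From mathcomp Require Import all_boot all_order all_algebra.
From mathcomp Require Import all_classical all_reals all_analysis.

Set Implicit Arguments.
Unset Strict Implicit.
Unset Printing Implicit Defensive.

Import Order.TTheory GRing.Theory Num.Theory.
Local Open Scope classical_set_scope.
Local Open Scope ring_scope.

Section Defs.
Context {R : realType}.

Definition mu_of {d} {Om : measurableType d} (mu0 mu1 : probability Om R)
  (s : bool) : probability Om R := if s then mu1 else mu0.

(** Private beliefs are unbounded from below.
    With nu = (mu0 + mu1)/2 the law of a signal, the private belief is
    B_u = P(S = 1 | W_u) = b(W_u) a.s., where b is a density of mu1/2
    with respect to nu, i.e. for all measurable A,
      \int_A b dmu0 + \int_A b dmu1 = mu1 A.
    Then P(B_u < eps) = nu(b < eps) = (mu0(b<eps) + mu1(b<eps))/2. *)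
Definition private_belief_density {d} {Om : measurableType d}
  (mu0 mu1 : probability Om R) (b : Om -> R) : Prop :=
  measurable_fun setT b /\ (forall w, 0 <= b w) /\
  forall A, measurable A ->
    (\int[mu0]_(w in A) (b w)%:E + \int[mu1]_(w in A) (b w)%:E = mu1 A)%E.

Definition beliefs_unbounded_below {d} {Om : measurableType d}
  (mu0 mu1 : probability Om R) : Prop :=
  exists b, private_belief_density mu0 mu1 b /\
    forall eps : R, 0 < eps ->
      (0 < mu0 [set w | (b w < eps)%R] + mu1 [set w | (b w < eps)%R])%E.

(** Joint law of (S, (W_u)_u): S uniform on {0,1} and, conditionally on S,
    the signals are i.i.d. with law mu_S.  Stated through the finite
    dimensional distributions: for every s and measurable A_u,
      P(S = s, W_u \in A_u for all u) = 1/2 * prod_u mu_s(A_u). *)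
Definition signal_model {d dO} {T : measurableType d} {Om : measurableType dO}
  (P : probability T R) (mu0 mu1 : probability Om R) (n : nat)
  (S : T -> bool) (W : 'I_n -> T -> Om) : Prop :=
  measurable [set t | S t] /\
  (forall u, measurable_fun setT (W u)) /\
  forall (s : bool) (A : 'I_n -> set Om), (forall u, measurable (A u)) ->
    fine (P ([set t | S t = s] `&` \bigcap_(u in [set: 'I_n]) (W u @^-1` A u)))
    = 2^-1 * \prod_(u < n) fine (mu_of mu0 mu1 s (A u)).

Definition sigma_of {d dO} {T : measurableType d} {Om : measurableType dO}
  (f : T -> Om) : set (set T) :=
  preimage_set_system setT f measurable.

Definition sigma_all {d dO} {T : measurableType d} {Om : measurableType dO}
  (n : nat) (W : 'I_n -> T -> Om) : set (set T) :=
  <<s \bigcup_(v in [set: 'I_n]) sigma_of (W v) >>.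

Definition info_algebras {d dO} {T : measurableType d} {Om : measurableType dO}
  (n : nat) (W : 'I_n -> T -> Om) (F : 'I_n -> set (set T)) : Prop :=
  forall u, sigma_algebra setT (F u) /\
            sigma_of (W u) `<=` F u /\ F u `<=` sigma_all W.

Definition F_measurable {d} {T : measurableType d} (F : set (set T))
  (X : T -> R) : Prop :=
  forall B : set R, measurable B -> F (X @^-1` B).

Definition is_posterior {d} {T : measurableType d} (P : probability T R)
  (S : T -> bool) (F : set (set T)) (X : T -> R) : Prop :=
  F_measurable F X /\
  P.-integrable setT (fun t => (X t)%:E) /\
  forall A, F A ->
    (\int[P]_(t in A) (X t)%:E = P (A `&` [set t | S t]))%E.

Definition opt_actions (x : R) : set bool :=
  if x < 2^-1 then [set false]
  else if 2^-1 < x then [set true]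
  else [set: bool].

Definition F_measurable_set {d} {T : measurableType d} (F : set (set T))
  (Y : T -> set bool) : Prop :=
  forall C : set (set bool), F (Y @^-1` C).

Definition common_knowledge {d} {T : measurableType d} (P : probability T R)
  (n : nat) (F : 'I_n -> set (set T)) (X : 'I_n -> T -> R) : Prop :=
  forall u w : 'I_n, exists Y : T -> set bool,
    F_measurable_set (F w) Y /\
    {ae P, forall t, Y t = opt_actions (X u t)}.

Definition common_action {d} {T : measurableType d} (P : probability T R)
  (n : nat) (X : 'I_n -> T -> R) (L : T -> set bool) : Prop :=
  (forall C : set (set bool), measurable (L @^-1` C)) /\
  forall u : 'I_n, {ae P, forall t, L t = opt_actions (X u t)}.

End Defs.

(* Main.v *)
Require Import Defs.
From HB Require Import structures.
From mathcomp Require Import all_boot all_order all_algebra.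
From mathcomp Require Import all_classical all_reals all_analysis.
From mathcomp Require Import ring lra.

Import Order.TTheory GRing.Theory Num.Theory numFieldNormedType.Exports.
Local Open Scope classical_set_scope.
Local Open Scope ring_scope.

(** Fix a small eps and let B be the signals of private belief below eps.  On
    the event E = {L <> {0}} every posterior is at least 1/2, and E is, up to a
    null set, F_u-measurable; so for each agent u, given E and W_u \in B, the
    state 0 is no likelier than the state 1, which is rare since W_u \in B.
    Hence E and {W_u \in B} are almost disjoint given S = 0, for every u.
    But given S = 0 these n events are independent with a common probability
    a > 0, so by a second moment argument E must be unlikely:
    P(E | S = 0) <= 3 eps + 1 / (4 eps n a). *)

(** * Integrals with real values over an event *)

(** Integrability travels with a finite value, so linear combinations of integrals are computed in
    [R] instead of the extended reals. *)
Definition has_int {d} {T : measurableType d} {R : realType}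
    (P : probability T R) (D : set T) (f : T -> R) (v : R) : Prop :=
  P.-integrable D (EFin \o f) /\ (\int[P]_(t in D) (f t)%:E = v%:E)%E.

Section HasInt.
Context {d : measure_display} {T : measurableType d} {R : realType}.
Context {P : probability T R} {D : set T}.
Hypothesis mD : measurable D.

Lemma has_int_indic {B : set T} : measurable B ->
  has_int P D \1_B (fine (P (B `&` D))).
Proof.
move=> mB; split.
  by apply: (@integrableS _ _ _ _ setT) => //; exact: integrable_indic.
by rewrite integral_indic// fineK// fin_num_measure//; exact: measurableI.
Qed.

Lemma has_intD {f g v w} : has_int P D f v -> has_int P D g w ->
  has_int P D (fun t => f t + g t) (v + w).
Proof.
move=> [fi fv] [gi gw]; split; first exact: (integrableD mD fi gi).
by under eq_integral do rewrite EFinD; rewrite integralD// fv gw.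
Qed.

Lemma has_intZ k {f v} : has_int P D f v -> has_int P D (fun t => k * f t) (k * v).
Proof.
move=> [fi fv]; split; first exact: (integrableZl mD k fi).
by under eq_integral do rewrite EFinM; rewrite integralZl// fv.
Qed.

Lemma has_int_cst k : has_int P D (fun=> k) (k * fine (P D)).
Proof.
have := has_intZ k (has_int_indic measurableT).
rewrite setTI; congr (has_int _ _ _ _).
by apply/funext => t; rewrite indicT mulr1.
Qed.

Lemma has_int_sum {n} (f : 'I_n -> T -> R) v : (forall i, has_int P D (f i) (v i)) ->
  has_int P D (fun t => \sum_(i < n) f i t) (\sum_(i < n) v i).
Proof.
move=> fv; elim: n f v fv => [|n IH] f v fv.
  have := has_int_cst 0; rewrite mul0r big_ord0; congr (has_int _ _ _ _).
  by apply/funext => t; rewrite big_ord0.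
rewrite big_ord_recr; under eq_fun do rewrite big_ord_recr.
by apply: has_intD => //; apply: IH.
Qed.

Lemma has_int_ge0 {f v} : has_int P D f v -> (forall t, D t -> 0 <= f t) -> 0 <= v.
Proof.
move=> [_ fv] f0; rewrite -lee_fin -fv.
by apply: integral_ge0 => t /f0; rewrite lee_fin.
Qed.
End HasInt.

(* With N the number of the A u that occur and M = n a, this integrates
   4 c (M - N) <= (N - M) ^ 2 + 4 c ^ 2 over E, enlarging the right-hand side
   to all of D; a conditional Chebyshev bound without division. *)
Lemma correlation_bound {d} {T : measurableType d} {R : realType}
    (P : probability T R) (D E : set T) (n : nat) (A : 'I_n -> set T)
    (a m c : R) :
  measurable D -> measurable E -> (forall u, measurable (A u)) ->
  fine (P D) = 2^-1 ->
  (forall u v, fine (P ((A u `&` A v) `&` D)) =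
     2^-1 * (if u == v then a else a * a)) ->
  (forall u, fine (P ((E `&` A u) `&` D)) <= 2^-1 * m) -> 0 <= c -> 0 <= a ->
  4 * c * (n%:R * a) * fine (P (E `&` D)) <=
    2 * c ^+ 2 + 2^-1 * (n%:R * a) + 2 * c * n%:R * m.
Proof.
move=> mD mE mA PD PAA PEA c0 a0.
set M := n%:R * a.
pose N t := \sum_(u < n) \1_(A u) t : R.
have sq t : \sum_(u < n) \sum_(v < n) \1_(A u `&` A v) t = N t * N t :> R.
  rewrite /N mulr_suml; apply: eq_bigr => u _; rewrite mulr_sumr.
  by apply: eq_bigr => v _; rewrite indicI.
have intN : has_int P D N (n%:R * (2^-1 * a)).
  rewrite mulr_natl -[X in _ *+ X]card_ord -sumr_const; apply: has_int_sum => // u.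
  by have := has_int_indic (P := P) mD (mA u); rewrite -[X in P (X `&` _)]setIid PAA eqxx.
have intNN : has_int P D (fun t => N t * N t) (\sum_(u < n) \sum_(v < n) (2^-1 * (if u == v then a else a * a))).
  under eq_fun do rewrite -sq.
  apply: has_int_sum => // u; apply: has_int_sum => // v; rewrite -PAA.
  by apply: has_int_indic => //; exact: measurableI.
have intEN : has_int P D (fun t => \1_E t * N t) (\sum_(u < n) fine (P ((E `&` A u) `&` D))).
  under eq_fun do rewrite mulr_sumr.
  apply: has_int_sum => // u; under eq_fun do rewrite -[_ * _]/((\1_E \* \1_(A u)) _) -indicI.
  by apply: has_int_indic => //; exact: measurableI.
have intE := has_int_indic (P := P) mD mE.
(* The integrand is [(N - M)^2 + 4 c^2 + 4 c 1_E (N - M)], expanded into terms whose integrals are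
   known. *)
have tot := has_intD mD (has_int_cst (P := P) mD (4 * c ^+ 2 + M ^+ 2))
 (has_intD mD intNN (has_intD mD (has_intZ mD (- (2 * M)) intN)
   (has_intD mD (has_intZ mD (4 * c) intEN) (has_intZ mD (- (4 * c * M)) intE)))).
have {tot} := has_int_ge0 tot.
set s2 := \sum_(u < n) _; set s1 := \sum_(u < n) _ .
(* Given [D], [N] has mean [M] and variance [M - M * a]. The final bound keeps only [M], dropping
   [M * a] by its sign. *)
have s2E : s2 = 2^-1 * (M * M + M - M * a).
  rewrite /s2 (eq_bigr (fun=> 2^-1 * (M * a + a - a * a))) => [|u _].
    by rewrite sumr_const card_ord -mulr_natl /M; ring.
  rewrite -mulr_sumr (eq_bigr (fun v => a * a + (if v == u then a - a * a else 0))).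
    by rewrite big_split/= sumr_const card_ord -big_mkcond big_pred1_eq -mulr_natl /M; ring.
  by move=> v _; rewrite eq_sym; case: ifP => _; ring.
have s1le : c * s1 <= c * (n%:R * (2^-1 * m)).
  apply: ler_wpM2l => //.
  by rewrite mulr_natl -[X in _ *+ X]card_ord -sumr_const; apply: ler_sum.
have Ma : 0 <= M * a by rewrite !mulr_ge0.
have -> : n%:R * (2^-1 * a) = 2^-1 * M by rewrite /M; ring.
rewrite PD s2E => tot.
suff pos : 0 <= (4 * c ^+ 2 + M ^+ 2) * 2^-1 + (2^-1 * (M * M + M - M * a) +
    (- (2 * M) * (2^-1 * M) + (4 * c * s1 + - (4 * c * M) * fine (P (E `&` D))))) by lra.
apply: tot => t Dt.
have : \1_E t = 0 :> R \/ \1_E t = 1 :> R.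
  by rewrite indicE; case: (_ \in _); [right|left].
case=> ->.
  have -> : 4 * c ^+ 2 + M ^+ 2 + (N t * N t + (- (2 * M) * N t +
    (4 * c * (0 * N t) + - (4 * c * M) * 0))) = (2 * c) ^+ 2 + (N t - M) ^+ 2 by ring.
  by rewrite addr_ge0 ?sqr_ge0.
have -> : 4 * c ^+ 2 + M ^+ 2 + (N t * N t + (- (2 * M) * N t +
    (4 * c * (1 * N t) + - (4 * c * M) * 1))) = (N t - M + 2 * c) ^+ 2 by ring.
exact: sqr_ge0.
Qed.

(** * Events and the signal model *)

Lemma fine_le_measure {d} {T : measurableType d} {R : realType}
    (P : probability T R) (A B : set T) :
  measurable A -> measurable B -> A `<=` B -> fine (P A) <= fine (P B).
Proof.
move=> mA mB AB; apply: fine_le; rewrite ?fin_num_measure//.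
by apply: le_measure; rewrite ?inE.
Qed.

Lemma measurable_eq_false {d} {T : measurableType d} (S : T -> bool) :
  measurable [set t | S t] -> measurable [set t | S t = false].
Proof.
move=> mS; rewrite (_ : [set t | _] = ~` [set t | S t]); first exact: measurableC.
by apply/seteqP; split => t /=; case: (S t).
Qed.

Lemma measurable_lt {d} {T : measurableType d} {R : realType} (f : T -> R) r :
  measurable_fun setT f -> measurable [set t | f t < r].
Proof.
move=> mf; rewrite (_ : [set t | _] = [set: T] `&` f @^-1` `]-oo, r[%classic).
  exact: mf.
by rewrite setTI; apply/seteqP; split => t /=; rewrite in_itv.
Qed.

(** Agents outside [J] are given the trivial constraint [setT]. Empty [J] yields the law of [S];
    singletons and pairs yield the moments of the number of agents with signal in [B]. *)
Lemma signal_model_all_in {d dO} {T : measurableType d} {Om : measurableType dO}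
    {R : realType} (P : probability T R) (mu0 mu1 : probability Om R) (n : nat)
    (S : T -> bool) (W : 'I_n -> T -> Om) (s : bool) (B : set Om)
    (J : {set 'I_n}) :
  signal_model P mu0 mu1 S W -> measurable B ->
  fine (P ([set t | S t = s] `&` \bigcap_(u in [set` J]) (W u @^-1` B))) =
  2^-1 * fine (mu_of mu0 mu1 s B) ^+ #|J|.
Proof.
move=> [_ [_ PW]] mB.
have -> : fine (mu_of mu0 mu1 s B) ^+ #|J| =
    \prod_(u < n) fine (mu_of mu0 mu1 s (if u \in J then B else setT)).
  rewrite -prodr_const big_mkcond/=; apply: eq_bigr => u _.
  by case: ifP => // _; rewrite probability_setT.
rewrite -PW; last by move=> u; case: ifP.
congr (fine (P (_ `&` _))); apply/seteqP; split => t /= H u.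
  by move=> _; case: ifP => // uJ; exact: (H u uJ).
by move=> /= uJ; have := H u I; rewrite uJ.
Qed.

(** * Posterior beliefs and optimal actions *)

Section Posterior.
Context {d : measure_display} {T : measurableType d} {R : realType}.
Variables (P : probability T R) (S : T -> bool) (F : set (set T)) (X : T -> R).
Hypothesis mS : measurable [set t | S t].
Hypotheses (sF : sigma_algebra setT F) (mF : F `<=` measurable).
Hypothesis XP : is_posterior P S F X.

Lemma posterior_ge_half_measurable : F [set t | 2^-1 <= X t].
Proof.
have := XP.1 `[2^-1, +oo[%classic (measurable_itv _).
by congr F; apply/seteqP; split => t /=; rewrite in_itv/= andbT.
Qed.

(** The event [H] where [X] is at least 1/2 within [G] lies in [F], so integrating [X] over it shows
    that [S = 1] carries at least half of its mass. Then [H] is enlarged to [G] on the right. *)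
Lemma posterior_ge_half (G : set T) : F G ->
  fine (P (([set t | 2^-1 <= X t] `&` G) `&` [set t | S t = false])) <=
  fine (P (G `&` [set t | S t = true])).
Proof.
move=> FG; set H := _ `&` G; have [_ [iX intX]] := XP.
have FH : F H.
  have [_ _ _ FI] := (sigma_algebraP (fun Y _ => @subsetT _ Y)).1 sF.
  by apply: FI => //; exact: posterior_ge_half_measurable.
have mH := mF _ FH; have mG := mF _ FG.
have mSF := measurable_eq_false S mS.
have half : (2^-1%:E * P H <= P (H `&` [set t | S t]))%E.
  rewrite -intX// -integral_cst//; apply: le_integral => //.
  - exact: finite_measure_integrable_cst.
  - exact: (integrableS measurableT).
  - by move=> t /set_mem[/= tX _]; rewrite lee_fin.
have PHE : (P H = P (H `&` [set t | S t = false]) + P (H `&` [set t | S t]))%E.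
  rewrite (measureDI P mH mS); congr (P _ + _)%E.
  by apply/seteqP; split => t /=; case: (S t) => -[].
have mHS : measurable (H `&` [set t | S t]) by exact: measurableI.
have mHSF : measurable (H `&` [set t | S t = false]) by exact: measurableI.
apply: (@le_trans _ _ (fine (P (H `&` [set t | S t])))); last first.
  apply: fine_le_measure => //; first exact: measurableI.
  by move=> t [[_ ? ?]].
move: half; rewrite PHE.
rewrite -[P (_ `&` [set t | S t])]fineK ?fin_num_measure//.
rewrite -[P (_ `&` [set t | S t = false])]fineK ?fin_num_measure//.
rewrite -EFinD -EFinM lee_fin; lra.
Qed.

End Posterior.

(** A tie gives both actions, which also differs from [[set false]]; hence the weak inequality. *)
Lemma opt_actions_neq_false {R : realType} (x : R) :
  opt_actions x <> [set false] <-> 2^-1 <= x.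
Proof.
rewrite /opt_actions leNgt; case: ltP => [//|_]; split => // _ E.
move: E; case: ifP => _ /seteqP[+ _].
  by move=> /(_ true erefl).
by move=> /(_ true I).
Qed.

Lemma ae_le_measure {d} {T : measurableType d} {R : realType}
    (P : probability T R) (A B : set T) : measurable A -> measurable B ->
  {ae P, forall t, A t -> B t} -> fine (P A) <= fine (P B).
Proof.
move=> mA mB [N [mN PN0 sN]].
have AB : A `<=` B `|` N.
  by move=> t At; have [Bt|nBt] := pselect (B t); [left|right; apply: sN => /(_ At)].
apply: le_trans (fine_le_measure P _ _ mA (measurableU _ _ mB mN) AB) _.
apply: fine_le; rewrite ?fin_num_measure//; first exact: measurableU.
by have := measureU2 P mB mN; rewrite [X in (_ <= _ + X)%E]PN0 adde0.
Qed.

(** * Low private beliefs and the uniform rate *)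

(** Integrating [b < eps] over [B] gives [mu1 B <= eps * (mu0 B + mu1 B)]. Since [eps <= 1/2], the
    last term is at most half of the left side and is absorbed there, which costs the factor 2. *)
Lemma low_belief_likelihood {dO} {Om : measurableType dO} {R : realType}
    (mu0 mu1 : probability Om R) (b : Om -> R) (eps : R) :
  private_belief_density mu0 mu1 b -> 0 < eps -> eps <= 2^-1 ->
  fine (mu1 [set w | b w < eps]) <= 2 * eps * fine (mu0 [set w | b w < eps]).
Proof.
move=> [mb [b0 bE]] e0 e2; set B := [set w | _].
have mB : measurable B := measurable_lt b eps mb.
have le (mu : probability Om R) : (\int[mu]_(w in B) (b w)%:E <= eps%:E * mu B)%E.
  rewrite -integral_cst//; apply: ge0_le_integral => //.
  - by move=> t _; rewrite lee_fin.
  - by apply/measurable_realfun.measurable_EFinP; exact: measurable_funTS.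
  - by move=> t /ltW; rewrite lee_fin.
have mu1E := bE B mB.
have : (mu1 B <= eps%:E * mu0 B + eps%:E * mu1 B)%E by rewrite -[leLHS]mu1E; exact: leeD.
rewrite -[mu1 B]fineK ?fin_num_measure// -[mu0 B]fineK ?fin_num_measure//.
rewrite -!EFinM -EFinD lee_fin /=.
have m0 : 0 <= fine (mu1 B) by exact: fine_ge0.
set m1 := fine (mu1 B) in m0 *; set m0' := fine (mu0 B) => h.
have : eps * m1 <= 2^-1 * m1 by exact: ler_wpM2r.
lra.
Qed.

(** Turns an epsilon statement, uniform over all values in [V n], into a single sequence [q]. *)
Lemma uniform_rate {R : realType} (V : nat -> set R) :
  (forall n v, V n v -> 0 <= v) ->
  (forall e, 0 < e -> \forall n \near \oo, forall v, V n v -> 1 - e <= v) ->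
  exists q : nat -> R, q @ \oo --> (1 : R) /\ forall n v, V n v -> q n <= v.
Proof.
(* Adjoining 1 keeps the set nonempty, so that its infimum is genuine, and bounds this infimum by
   1. *)
move=> V0 V1; pose VE n := V n `|` [set 1].
have lb n : lbound (VE n) 0 by move=> v [/V0//|->]; exact: ler01.
have hlb n : has_lbound (VE n) by exists 0.
exists (fun n => inf (VE n)); split; last first.
  by move=> n v Vv; apply: ge_inf => //; left.
apply/cvgrPdist_le => e e0; near=> n.
rewrite ger0_norm ?subr_ge0; last by apply: ge_inf => //; right.
rewrite lerBlDr -lerBlDl; apply: lb_le_inf; first by exists 1; right.
move=> v [Vv|->]; last by rewrite gerBl ltW.
by move: v Vv; near: n; exact: V1.
Unshelve. all: by end_near. Qed.

(** The lower bound on [n] says that [1 / (4 eps n a)] is at most [3 eps], so the total error is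
    [6 eps]. *)
Lemma agreement_bound {d dO} {T : measurableType d} {Om : measurableType dO}
    {R : realType} (P : probability T R) (mu0 mu1 : probability Om R) (n : nat)
    (S : T -> bool) (W : 'I_n -> T -> Om) (F : 'I_n -> set (set T))
    (X : 'I_n -> T -> R) (L : T -> set bool) (B : set Om) (eps : R) :
  signal_model P mu0 mu1 S W -> info_algebras W F ->
  (forall u, is_posterior P S (F u) (X u)) -> common_action P X L ->
  measurable B -> 0 < eps ->
  fine (mu1 B) <= 2 * eps * fine (mu0 B) ->
  1 <= 12 * eps ^+ 2 * (n%:R * fine (mu0 B)) ->
  1 - 6 * eps <= fine (P [set t | L t = [set false] /\ S t = false])
    / fine (P [set t | S t = false]).
Proof.
move=> model infoF XP [mL LX] mB e0 m1le nlarge.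
set a := fine (mu0 B) in m1le nlarge *; set m1 := fine (mu1 B) in m1le *.
set D := [set t | S t = false].
have [mS [mW _]] := model.
have mD : measurable D := measurable_eq_false S mS.
pose E := L @^-1` (~` [set [set false]]).
have mE : measurable E by exact: mL.
pose A u := W u @^-1` B.
have mA u : measurable (A u) by rewrite -[A u]setTI; exact: mW.
have PD : fine (P D) = 2^-1.
  have := signal_model_all_in P mu0 mu1 n S W false B finset.set0 model mB.
  rewrite cards0 expr0 mulr1 => <-; congr (fine (P _)).
  by apply/seteqP; split => [t Dt|t []//]; split => // u; rewrite /= inE.
have PAA u v : fine (P (A u `&` A v `&` D)) = 2^-1 * (if u == v then a else a * a).
  have -> : (if u == v then a else a * a) = a ^+ #|[set u; v]%SET|.
    by rewrite cards2; case: eqVneq.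
  rewrite -(signal_model_all_in P mu0 mu1 n S W false B _ model mB).
  congr (fine (P _)); apply/seteqP; split => t /=.
    by move=> [[Au Av] Dt]; split => // w /=; rewrite !inE => /orP[]/eqP->.
  by move=> [Dt H]; split => //; split; apply: H; rewrite /= !inE eqxx ?orbT.
have PEA u : fine (P (E `&` A u `&` D)) <= 2^-1 * m1.
  have [sF [WF FW]] := infoF u.
  have mF : F u `<=` measurable.
    apply: subset_trans FW _; apply: smallest_sub.
      exact: sigma_algebra_measurable.
    by move=> Y [v _ [C mC <-]]; apply: mW.
  have FA : F u (A u) by apply: WF; exists B => //; rewrite setTI.
  (* [E] itself need not belong to [F u]; it is replaced by the event that [X u] is at least 1/2,
     which does and which contains [E] up to a null set. *)
  have := posterior_ge_half P S (F u) (X u) mS sF mF (XP u) _ FA.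
  have -> : fine (P (A u `&` [set t | S t = true])) = 2^-1 * m1.
    have := signal_model_all_in P mu0 mu1 n S W true B [set u]%SET model mB.
    rewrite cards1 expr1 => <-.
    congr (fine (P _)); apply/seteqP; split => t /=.
      by move=> [Au Dt]; split => // w /=; rewrite !inE => /eqP->.
    by move=> [Dt H]; split => //; apply: H; rewrite /= !inE eqxx.
  apply: le_trans; apply: ae_le_measure.
  - by apply: measurableI => //; exact: measurableI.
  - apply: measurableI => //; apply: measurableI => //; apply: mF.
    exact: posterior_ge_half_measurable (XP u).
  - apply: filterS (LX u) => t Lt [[Et At] Dt]; split => //; split => //.
    by apply/opt_actions_neq_false; rewrite -Lt.
have a0 : 0 <= a by exact: fine_ge0.
pose M := n%:R * a.
have M0 : 0 < M.
  rewrite lt_neqAle mulr_ge0// andbT eq_sym; apply/negP => /eqP M0.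
  by move: nlarge; rewrite -/M M0 mulr0 ler10.
have e0' := ltW e0.
(* With [c = eps * M], division by [2 eps M^2] bounds [2 P(E and D)] by
   [eps + 1 / (4 eps M) + n m1 / M], whose last term is at most [2 eps]. *)
have := correlation_bound P D E n A a m1 (eps * M) mD mE mA PD PAA PEA
  (mulr_ge0 e0' (ltW M0)) a0.
rewrite -/M; set e := fine (P (E `&` D)) => bound.
have -> : fine (P [set t | L t = [set false] /\ S t = false]) = 2^-1 - e.
  have : fine (P D) = fine (P [set t | L t = [set false] /\ S t = false]) + e.
    rewrite (measureDI P mD mE) fineD ?fin_num_measure//; last 2 first.
    - exact: measurableD.
    - exact: measurableI.
    rewrite setIC; congr (fine (P _) + _); apply/seteqP; split => t /=.
      by move=> [Dt /contrapT Lt].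
    by move=> [Lt Dt]; split => //; apply.
  by rewrite PD => ->; ring.
rewrite PD invrK mulrBl mulVf ?pnatr_eq0// lerD2l lerN2.
have h1 : eps * M * (n%:R * m1) <= eps * M * (2 * eps * M).
  apply: ler_wpM2l; first by rewrite mulr_ge0// ltW.
  rewrite /M mulrCA; exact: ler_wpM2l.
have h2 : M * 1 <= M * (12 * eps ^+ 2 * M) by apply: ler_wpM2l => //; exact: ltW.
have MM : 0 < 2 * eps * M * M by do 3!apply: mulr_gt0 => //.
rewrite -(ler_pM2l MM); lra.
Qed.

Theorem theorem3 (R : realType) (dO : measure_display) (Om : measurableType dO)
  (mu0 mu1 : probability Om R) :
  (exists A : set Om, measurable A /\ mu0 A <> mu1 A) ->
  beliefs_unbounded_below mu0 mu1 ->
  exists q : nat -> R, q @ \oo --> (1 : R) /\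
    forall (n : nat) (d : measure_display) (T : measurableType d)
      (P : probability T R) (S : T -> bool) (W : 'I_n -> T -> Om)
      (F : 'I_n -> set (set T)) (X : 'I_n -> T -> R) (L : T -> set bool),
      signal_model P mu0 mu1 S W ->
      info_algebras W F ->
      (forall u, is_posterior P S (F u) (X u)) ->
      common_knowledge P F X ->
      common_action P X L ->
      q n <= fine (P [set t | L t = [set false] /\ S t = false])
             / fine (P [set t | S t = false]).
Proof.
move=> _ [b [bd b_small]].
(* Collecting the values over all probability spaces and models makes [q] depend on [mu0] and [mu1]
   only. *)
pose V n : set R := [set v | exists (d : measure_display) (T : measurableType d)
  (P : probability T R) (S : T -> bool) (W : 'I_n -> T -> Om)
  (F : 'I_n -> set (set T)) (X : 'I_n -> T -> R) (L : T -> set bool),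
  [/\ signal_model P mu0 mu1 S W, info_algebras W F,
      forall u, is_posterior P S (F u) (X u), common_action P X L &
      v = fine (P [set t | L t = [set false] /\ S t = false])
          / fine (P [set t | S t = false])]].
have [|eta eta0|q [q1 qV]] := uniform_rate V; last first.
- exists q; split => // n d T P S W F X L model infoF XP _ LX.
  by apply: qV; exists d, T, P, S, W, F, X, L.
(* The bound 1/2 serves the likelihood estimate; [eta / 6] matches the error [6 eps]. *)
- pose eps := Num.min 2^-1 (eta / 6).
  have eps0 : 0 < eps by rewrite lt_min invr_gt0 ltr0n divr_gt0.
  have eps2 : eps <= 2^-1 by rewrite ge_min lexx.
  have epse : 6 * eps <= eta by rewrite mulrC -ler_pdivlMr// ge_min lexx orbT.
  pose B := [set w | b w < eps].
  have m1le : fine (mu1 B) <= 2 * eps * fine (mu0 B).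
    exact: low_belief_likelihood.
  have mB : measurable B := measurable_lt b eps bd.1.
  (* Unboundedness only says that [mu0] or [mu1] charges [B]; by [m1le], a [mu0]-null [B] would be
     [mu1]-null as well. *)
  have a0 : 0 < fine (mu0 B).
    rewrite lt_neqAle fine_ge0// andbT; apply/eqP => E; move: m1le.
    have := b_small eps eps0; rewrite -/B.
    rewrite -[mu1 B]fineK ?fin_num_measure// -[mu0 B]fineK ?fin_num_measure//.
    by rewrite -EFinD lte_fin /= -E mulr0; lra.
  near=> n => v [d [T [P [S [W [F [X [L [model infoF XP LX ->]]]]]]]]].
  apply: le_trans (agreement_bound P mu0 mu1 n S W F X L B eps model infoF XP LX mB eps0 m1le _).
    by rewrite lerD2l lerN2.
  (* The threshold [1 / (12 eps^2 mu0 B)] for [n] involves no model, so it serves all models at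
     once. *)
  rewrite mulrCA -ler_pdivrMr.
    by near: n; exact: nbhs_infty_ger.
  by rewrite mulr_gt0// mulr_gt0// exprn_gt0.
- move=> n v [d [T [P [S [W [F [X [L [_ _ _ _ ->]]]]]]]]].
  by apply: divr_ge0; exact: fine_ge0.
Unshelve. all: by end_near. Qed.
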